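(* Let $b\geq 2$ be an integer, $\mathcal{A}=\{0,\dots,b-1\}$, $k$ a positive integer and $r$ a positive integer coprime with $b$. Identify each word in $\mathcal{A}^k$ with an integer modulo $b^k$ via its base-$b$ representation (with $k$ digits). Let $s$ be the word of length $kb^k$ obtained by concatenating the words of $\mathcal{A}^k$ corresponding to $0, r, 2r, \dots, (b^k-1)r$ (taken modulo $b^k$), in this order. Then the necklace $[s]$ is $(k,k)$-perfect.
   Context: A necklace is the equivalence class of a word under cyclic rotations. A word $u$ of length $k$ occurs in a necklace $[s]$ (with $|s|=N$) at position $i$ if $s((i+t)\bmod N)=u(t)$ for $t=0,\dots,k-1$. A necklace is $(k,n)$-perfect if it has length $n|\mathcal{A}|^k$ and each word of length $k$ occurs in it exactly $n$ times, at positions that are pairwise different modulo $n$. A necklace is called perfect if it is $(k,k)$-perfect for some $k$. *)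

(* Defs.v *)
From mathcomp Require Import all_boot.
From mathcomp Require Import generic_quotient.

Set Implicit Arguments.
Unset Strict Implicit.
Unset Printing Implicit Defensive.

Section Necklace.
Variable A : finType.
Implicit Types (s t u : seq A).

Definition rot_equiv : rel (seq A) :=
  fun s t => t \in [seq rot i s | i <- iota 0 (size s).+1].

Lemma rot_equivP s t :
  reflect (exists2 i, i <= size s & t = rot i s) (rot_equiv s t).
Proof.
apply: (iffP mapP) => -[i hi ->]; exists i => //.
  by move: hi; rewrite mem_iota.
by rewrite mem_iota.
Qed.

Lemma rot_equiv_is_equiv : equiv_class_of rot_equiv.
Proof.
have sym s t : rot_equiv s t -> rot_equiv t s.
  case/rot_equivP=> i le_is ->; apply/rot_equivP.
  exists (size (rot i s) - i); first exact: leq_subr.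
  by rewrite -{1}(rotK i s).
split=> [s|s t|t s u].
- by apply/rot_equivP; exists 0; rewrite ?rot0.
- by apply/idP/idP; apply: sym.
case/rot_equivP=> i le_is -> /rot_equivP[j]; rewrite size_rot => le_js ->.
apply/rot_equivP; rewrite rot_add_mod //; set m := (X in rot X s).
by exists m; rewrite // /m; case: ifP => // _; rewrite leq_subLR leq_add.
Qed.

Canonical rot_equiv_equiv := EquivRelPack rot_equiv_is_equiv.
Canonical rot_equiv_encModRel := defaultEncModRel rot_equiv.

Definition necklace := {eq_quot rot_equiv}%qT.

Definition necklace_of s : necklace := (\pi_necklace s)%qT.

(* The position i + j is reduced modulo the length of s, so occurrences may
   wrap around s, several times if u is longer than s. *)
Definition occurs_at s u i : bool :=
  all (fun j => onth s ((i + j) %% size s) == onth u j) (iota 0 (size u)).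

Definition positions s u : seq nat :=
  [seq i <- iota 0 (size s) | occurs_at s u i].

(* Rotating s translates all positions modulo its length, a multiple of n, so
   the condition does not depend on the representative s of the necklace; it is
   required of all of them. *)
Definition perfect_necklace (k n : nat) (x : necklace) : Prop :=
  forall s, necklace_of s = x ->
    size s = n * #|A| ^ k /\
    forall u : k.-tuple A,
      size (positions s u) = n /\
      {in positions s u &, injective (fun i => i %% n)}.

End Necklace.

Section BaseWords.
Variables (b : nat) (hb : 1 < b).

Definition digit (m : nat) : 'I_b := Ordinal (ltn_pmod m (ltnW hb)).

(* Most significant digit first. *)
Definition base_word (k m : nat) : k.-tuple 'I_b :=
  [tuple digit (m %/ b ^ (k - j.+1)) | j < k].

Definition base_value (k : nat) (w : k.-tuple 'I_b) : nat :=
  \sum_(j < k) tnth w j * b ^ (k - j.+1).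

Lemma base_word_value (k m : nat) :
  base_value (base_word k m) = m %% b ^ k.
Proof.
rewrite /base_value; under eq_bigr => j _ do rewrite tnth_mktuple /=.
rewrite (reindex_inj rev_ord_inj) /=.
under eq_bigr => j _ do rewrite subnSK // subKn 1?ltnW //.
elim: k => [|k IHk]; first by rewrite big_ord0 modn1.
rewrite big_ord_recr /= IHk.
rewrite {3}(divn_eq m (b ^ k)) {2}(divn_eq (m %/ b ^ k) b).
have b0 : 0 < b by exact: ltnW.
rewrite mulnDl -mulnA -expnS -addnA modnMDl [RHS]modn_small; first by rewrite addnC.
apply: (@leq_trans (((m %/ b ^ k) %% b).+1 * b ^ k)).
  by rewrite mulSn addnC ltn_add2r ltn_pmod ?expn_gt0 ?b0.
by rewrite expnS leq_mul2r ltn_pmod ?orbT.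
Qed.

Definition arith_word (k r : nat) : seq 'I_b :=
  flatten [seq tval (base_word k ((i * r) %% b ^ k)) | i <- iota 0 (b ^ k)].

End BaseWords.

(* Main.v *)
Require Import Defs.
From mathcomp Require Import all_boot.
From mathcomp Require Import generic_quotient zify.

(** The map sending a position [i] to the pair ([i] mod [k], word of length [k]
    read at [i]) goes between two sets of cardinality [k * b ^ k], so it suffices
    that it is injective.  If [i = q * k + m], the word read at [i] consists of
    the [k - m] low digits of [q * r] followed by the [m] high digits of
    [q.+1 * r].  Adding [r], the former determine the [k - m] low digits of
    [q.+1 * r], so the whole of [q.+1 * r] modulo [b ^ k] is known; as [r] is
    invertible modulo [b ^ k], so is [q]. *)

Lemma eqn_mod_mul2r (d r m n : nat) :
  coprime d r -> m * r = n * r %[mod d] -> m = n %[mod d].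
Proof.
(* Subtraction on [nat] is truncated, so the congruence is read as divisibility of [m - n] only once
   [n <= m]. *)
move=> co_dr; wlog le_nm : m n / n <= m => [hwlog|].
  by case: (leqP n m) => [/hwlog|/ltnW/hwlog h /esym/h ->].
move/eqP; rewrite eqn_mod_dvd ?leq_mul2r ?le_nm ?orbT // -mulnBl.
by rewrite Gauss_dvdl // => h; apply/eqP; rewrite eqn_mod_dvd.
Qed.

Lemma onth_flatten_map (T S : Type) (k : nat) (F : T -> seq S) (l : seq T)
    (q m : nat) :
  (forall i, size (F i) = k) -> m < k ->
  onth (flatten [seq F i | i <- l]) (q * k + m) =
  obind (fun i => onth (F i) m) (onth l q).
Proof.
move=> szF lt_mk; elim: l q => [|x l IHl] q; first by rewrite !onth0n.
case: q => [|q]; rewrite /= onth_cat szF.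
  by rewrite lt_mk.
by rewrite mulSn -addnA ltnNge leq_addr addKn IHl.
Qed.

Lemma onth_rot (T : Type) (n i : nat) (s : seq T) :
  n <= size s -> i < size s ->
  onth (rot n s) i = onth s ((i + n) %% size s).
Proof.
move=> le_ns lt_is; rewrite onth_cat size_drop.
have onth_drop j : onth (drop n s) j = onth s (n + j).
  by rewrite !onthE map_drop nth_drop.
have onth_take j : j < n -> onth (take n s) j = onth s j.
  by move=> lt_jn; rewrite !onthE map_take nth_take.
case: ltnP => [lt_i|le_i]; first by rewrite onth_drop addnC modn_small //; lia.
rewrite onth_take; last lia.
have -> : i + n = i - (size s - n) + size s by lia.
by rewrite modnDr modn_small //; lia.
Qed.

Section Digits.
Variables (b : nat) (hb : 1 < b).

(** The digits of weights [b ^ d], [d < k], are the letters of [base_word], whose value is the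
    residue modulo [b ^ k]. *)
Lemma digits_inj (k x y : nat) :
  (forall d, d < k -> digit hb (x %/ b ^ d) = digit hb (y %/ b ^ d)) ->
  x = y %[mod b ^ k].
Proof.
move=> eq_xy; rewrite -!(base_word_value hb); congr base_value.
by apply: eq_from_tnth => j; rewrite !tnth_mktuple eq_xy //; have := ltn_ord j; lia.
Qed.

Lemma eq_digit_mod (k x y d : nat) :
  x = y %[mod b ^ k] -> d < k ->
  digit hb (x %/ b ^ d) = digit hb (y %/ b ^ d).
Proof.
move=> eq_xy lt_dk; apply: val_inj; rewrite /= !modn_divl -expnS.
have dvd_bb : b ^ d.+1 %| b ^ k by rewrite dvdn_exp2l.
by rewrite -(modn_dvdm x dvd_bb) eq_xy modn_dvdm.
Qed.

Section ArithWord.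
Variables (k r : nat).

(** Periodic extension of [arith_word] to all of [nat]: the product with [r] is left unreduced,
    since the digits extracted have weight below [b ^ k]. *)
Definition arith_letter (n : nat) : 'I_b :=
  digit hb (n %/ k * r %/ b ^ (k - (n %% k).+1)).

Hypothesis k_gt0 : 0 < k.

Lemma size_arith_word : size (arith_word hb k r) = k * b ^ k.
Proof.
rewrite size_flatten /shape -map_comp.
under eq_map => i do rewrite /= size_tuple.
by rewrite sumnE big_map big_const_seq count_predT iter_addn_0 size_iota card_ord.
Qed.

(** Reducing [n] modulo [k * b ^ k] keeps its offset in the block and reduces the block index modulo
    [b ^ k], which does not affect the low [k] digits of its multiple by [r]. *)
Lemma onth_arith_word (n : nat) :
  onth (arith_word hb k r) (n %% (k * b ^ k)) = Some (arith_letter n).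
Proof.
have bk_gt0 : 0 < b ^ k by rewrite expn_gt0 (ltnW hb).
set q := n %/ k; set m := n %% k.
have lt_mk : m < k by rewrite ltn_mod.
have -> : n %% (k * b ^ k) = q %% b ^ k * k + m.
  rewrite {1}(divn_eq n k) -/q -/m (mulnC k) muln_modl.
  rewrite -modnDml modn_small // -muln_modl.
  apply: (@leq_trans ((q %% b ^ k).+1 * k)); first by rewrite mulSn addnC ltn_add2r.
  by rewrite leq_mul2r ltn_mod bk_gt0 orbT.
rewrite (@onth_flatten_map _ _ k) //; last by move=> i; rewrite size_tuple.
have -> : onth (iota 0 (b ^ k)) (q %% b ^ k) = Some (q %% b ^ k).
  by rewrite onthE (nth_map 0) ?size_iota ?ltn_mod // nth_iota ?ltn_mod.
apply/(tnth_onth _ (base_word hb k (q %% b ^ k * r %% b ^ k)) (Ordinal lt_mk)).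
rewrite tnth_mktuple /=; apply: (@eq_digit_mod k); last lia.
by rewrite modn_mod modnMml.
Qed.

Lemma arith_letter_block (q d : nat) :
  d < k -> arith_letter (q * k + (k - d.+1)) = digit hb (q * r %/ b ^ d).
Proof.
move=> lt_dk; have lt_pk : k - d.+1 < k by lia.
rewrite /arith_letter divnMDl // modnMDl (divn_small lt_pk) (modn_small lt_pk).
by rewrite addn0 subnSK // subKn // ltnW.
Qed.

Lemma arith_letter_window_inj (i j : nat) :
  coprime r b -> i = j %[mod k] ->
  (forall t, t < k -> arith_letter (i + t) = arith_letter (j + t)) ->
  i = j %[mod k * b ^ k].
Proof.
move=> co_rb; rewrite (divn_eq i k) (divn_eq j k).
set q := i %/ k; set q' := j %/ k; set m := i %% k.
rewrite !modnMDl !modn_mod => <-; rewrite -/m => eq_win.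
have lt_mk : m < k by rewrite ltn_mod.
suff eq_q : q = q' %[mod b ^ k].
  by rewrite -modnDml -[RHS]modnDml (mulnC k) -!muln_modl eq_q.
(* The digit of weight [b ^ d] has offset [k - d.+1] in its block; for [d < k - m] this is at least
   [m], so the window, starting at offset [m], contains it. *)
have low : q * r = q' * r %[mod b ^ (k - m)].
  apply: digits_inj => d lt_d; have lt_dk : d < k by lia.
  have def_p : m + (k - d.+1 - m) = k - d.+1 by lia.
  rewrite -!arith_letter_block // -def_p !addnA; apply: eq_win; lia.
(* The next block starts [k - m] letters into the window, which therefore contains its first [m]
   letters. For [m = 0] there is no such [d], and [low] covers every digit. *)
have high d : k - m <= d -> d < k ->
    digit hb (q.+1 * r %/ b ^ d) = digit hb (q'.+1 * r %/ b ^ d).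
  move=> le_d lt_d; have lt_t : k - m + (k - d.+1) < k by clear low; lia.
  have shift p : p.+1 * k + (k - d.+1) = p * k + m + (k - m + (k - d.+1)).
    by rewrite mulSn addnA -(addnA (p * k)) (subnKC (ltnW lt_mk)) (addnC k).
  by rewrite -!arith_letter_block // !shift eq_win.
have lowS : q.+1 * r = q'.+1 * r %[mod b ^ (k - m)].
  by rewrite !mulSn -modnDmr low modnDmr.
have eqS : q.+1 * r = q'.+1 * r %[mod b ^ k].
  apply: digits_inj => d lt_d.
  by have [/high->|/(eq_digit_mod _ _ _ _ lowS)] := leqP (k - m) d.
have co_bk : coprime (b ^ k) r by rewrite coprime_sym coprimeXr.
have /eqP := eqn_mod_mul2r _ _ _ _ co_bk eqS.
by rewrite -(addn1 q) -(addn1 q') eqn_modDr => /eqP.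
Qed.

End ArithWord.
End Digits.

Section WindowInjective.
Variables (A : finType) (k n : nat) (s : seq A) (f : nat -> A).
Let N := n * #|A| ^ k.
Hypotheses (n_gt0 : 0 < n) (size_s : size s = N).
Hypothesis onth_s : forall x, onth s (x %% N) = Some (f x).
Hypothesis window_inj : forall i j, i = j %[mod n] ->
  (forall t, t < k -> f (i + t) = f (j + t)) -> i = j %[mod N].

(** Reading letters through [f] absorbs the wrap-around in [occurs_at]. *)
Lemma occurs_atP (u : k.-tuple A) (i : nat) :
  reflect (forall t : 'I_k, f (i + t) = tnth u t) (occurs_at s u i).
Proof.
apply: (iffP allP) => [occ t|occ t].
  have /occ : val t \in iota 0 (size u) by rewrite mem_iota size_tuple /=.
  by rewrite size_s onth_s => /eqP/esym/tnth_onth ->.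
rewrite mem_iota size_tuple => /= lt_tk.
rewrite size_s onth_s -[t]/(val (Ordinal lt_tk)) occ eq_sym.
by apply/eqP/tnth_onth.
Qed.

Lemma positions_inj (u : k.-tuple A) :
  {in positions s u &, injective (fun i => i %% n)}.
Proof.
move=> i j; rewrite !mem_filter !mem_iota size_s.
case/andP=> /occurs_atP occ_i /= lt_i /andP[/occurs_atP occ_j /= lt_j] eq_ij.
rewrite -(modn_small lt_i) -(modn_small lt_j); apply: window_inj => // t lt_tk.
by rewrite -[t]/(val (Ordinal lt_tk)) occ_i occ_j.
Qed.

Lemma positions_surj (u : k.-tuple A) (m : nat) :
  m < n -> exists2 i, i \in positions s u & i %% n = m.
Proof.
move=> lt_mn.
(* Surjectivity of [g] gives a position for each prescribed residue and word. *)
pose g (i : 'I_N) : 'I_n * k.-tuple A :=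
  (Ordinal (ltn_pmod i n_gt0), [tuple f (i + t) | t < k]).
have g_inj : injective g.
  move=> i j [eq_mod eq_win]; apply: val_inj => /=.
  rewrite -(modn_small (ltn_ord i)) -(modn_small (ltn_ord j)).
  apply: window_inj => // t lt_tk.
  have /(congr1 (fun w => tnth w (Ordinal lt_tk))) :
    [tuple f (i + t) | t < k] = [tuple f (j + t) | t < k] by apply: val_inj.
  by rewrite !tnth_mktuple.
have card_g : #|{: 'I_n * k.-tuple A}| <= #|'I_N|.
  by rewrite card_prod card_tuple !card_ord.
have /codomP[i def_mu] := inj_card_onto g_inj card_g (Ordinal lt_mn, u).
have [-> ->] : u = (g i).2 /\ m = i %% n
  by rewrite -def_mu; case: def_mu.
exists (val i) => //; rewrite mem_filter mem_iota size_s leq0n add0n ltn_ord !andbT.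
by apply/occurs_atP => t; rewrite tnth_mktuple.
Qed.

(** The residues modulo [n] of the positions are distinct and exhaust [iota 0 n]. *)
Lemma size_positions (u : k.-tuple A) : size (positions s u) = n.
Proof.
rewrite -(size_map (fun i => i %% n)) -[RHS](size_iota 0 n).
apply/perm_size/uniq_perm; rewrite ?iota_uniq //.
  by rewrite (map_inj_in_uniq (@positions_inj u)) filter_uniq ?iota_uniq.
move=> m; rewrite mem_iota /=; apply/mapP/idP => [[i _ ->]|/positions_surj-/(_ u)].
  by rewrite ltn_mod.
by case=> i pos_i <-; exists i.
Qed.

End WindowInjective.

Theorem theorem2p3 (b k r : nat) (hb : 1 < b) (hk : 0 < k) (hr : 0 < r)
    (hrb : coprime r b) :
  perfect_necklace k k (necklace_of (arith_word hb k r)).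
Proof.
move=> s /esym/eqmodP/rot_equivP[i0]; set w := arith_word hb k r => le_i0 def_s.
have size_w : size w = k * #|'I_b| ^ k by rewrite size_arith_word // card_ord.
have size_s : size s = k * #|'I_b| ^ k by rewrite def_s size_rot.
have N_gt0 : 0 < k * #|'I_b| ^ k.
  by rewrite card_ord muln_gt0 hk expn_gt0 (ltnW hb).
(* Any representative [s] is a rotation of [w] by some [i0], so its letters are those of [w]
   translated by [i0]; the translation cancels in the congruences of [win_inj]. *)
have onth_s x : onth s (x %% (k * #|'I_b| ^ k)) =
                Some (arith_letter b hb k r (x + i0)).
  rewrite def_s onth_rot //; last by rewrite size_w ltn_mod.
  by rewrite size_w modnDml card_ord onth_arith_word.
have win_inj i j : i = j %[mod k] ->
    (forall t, t < k ->
       arith_letter b hb k r (i + t + i0) = arith_letter b hb k r (j + t + i0)) ->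
    i = j %[mod k * #|'I_b| ^ k].
  move=> eq_ij eq_win; apply/eqP; rewrite -(eqn_modDr i0) card_ord.
  apply/eqP; apply: (@arith_letter_window_inj _ hb k r hk) => // [|t /eq_win].
    by rewrite -modnDml eq_ij modnDml.
  by rewrite !(addnAC _ i0).
split=> // u; split.
  exact: (@size_positions _ _ _ _ _ hk size_s onth_s win_inj).
exact: (@positions_inj _ _ _ _ _ size_s onth_s win_inj).
Qed.
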